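(* (i) The rational points $(x_1,x_2)\in\mathbb{Q}^2$ of the curve $2(x_1^4+x_2^4)(x_1^2+x_2^2+1)=3(x_1^2+x_2^2)^2$ are exactly $(-1,-1),(-1,1),(0,0),(1,-1),(1,1)$. In particular, for no $\lambda>-1/2$ does there exist a rational $5$-design with $4$ points for the Gegenbauer measure $(1-t^2)^{\lambda-1/2}dt/\int_{-1}^1(1-t^2)^{\lambda-1/2}dt$ on $(-1,1)$. (ii) The rational points $(x_1,x_2)\in\mathbb{Q}^2$ of the curve $(x_1^4+x_2^4)(4x_1^2+4x_2^2+5)=6(x_1^2+x_2^2)^2$ are exactly $(-\tfrac12,0),(0,-\tfrac12),(0,0),(0,\tfrac12),(\tfrac12,0)$. In particular, for no $\lambda>-1/2$ does there exist a rational $5$-design with $5$ points for the Gegenbauer measure $(1-t^2)^{\lambda-1/2}dt/\int_{-1}^1(1-t^2)^{\lambda-1/2}dt$ on $(-1,1)$.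
   Context: An $m$-design with $n$ points for a probability measure $w(t)dt$ on an interval $I$ is a set of $n$ pairwise distinct points $x_1,\dots,x_n\in I$ with $\frac1n\sum_i f(x_i)=\int_I f(t)w(t)dt$ for every real polynomial $f$ of degree at most $m$; it is rational if all $x_i\in\mathbb{Q}$. *)

(* Defs.v *)
From HB Require Import structures.
From mathcomp Require Export all_boot all_order all_algebra.
From mathcomp Require Export all_classical all_reals all_analysis.

Set Implicit Arguments.
Unset Strict Implicit.
Unset Printing Implicit Defensive.

Import Order.TTheory GRing.Theory Num.Theory.
Import numFieldNormedType.Exports.

Local Open Scope classical_set_scope.
Local Open Scope ring_scope.

(* The quadrature identity is stated in \bar R, so that it can only hold when *)
(* the integral of f * w over I is finite. Recall that size f is deg f + 1.   *)
Definition is_design (R : realType) (m n : nat) (I : set R) (w : R -> R)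
    (x : 'I_n -> R) : Prop :=
  [/\ injective x,
      forall i : 'I_n, I (x i) &
      forall f : {poly R}, (size f <= m.+1)%N ->
        (n%:R^-1 * \sum_(i < n) f.[x i])%:E =
        (\int[lebesgue_measure]_(t in I) (f.[t] * w t)%:E)%E].

Definition is_rational_design (R : realType) (m n : nat) (I : set R)
    (w : R -> R) (x : 'I_n -> R) : Prop :=
  is_design m I w x /\ forall i : 'I_n, exists q : rat, x i = ratr q.

Definition gegenbauer_weight (R : realType) (lambda t : R) : R :=
  (1 - t ^+ 2) `^ (lambda - 2^-1).

Definition gegenbauer_density (R : realType) (lambda t : R) : R :=
  gegenbauer_weight lambda t /
  \int[lebesgue_measure]_(s in `]-1, 1[) gegenbauer_weight lambda s.

(* Main.v *)
(** Writing x2 / x1 = b / a in lowest terms, the two curves say that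
    2 (a^2 + b^2) (a^4 + b^4) (a^4 + 6 a^2 b^2 + b^4), respectively
    (a^2 + b^2) (a^4 + b^4) (a^4 + 12 a^2 b^2 + b^4), is a perfect square.
    Away from 2 the factor a^4 + b^4 is coprime to the other two, so parity
    leaves only a^4 + b^4 = 2 c^2, respectively a^4 + b^4 = c^2; Fermat's
    descent gives a = b, respectively a b = 0.

    For designs, integrating the derivative of t^k (1 - t^2)^(lambda + 1/2)
    over ]-1, 1[ yields k M_(k-1) = (k + 2 lambda + 1) M_(k+1) for the moments.
    Hence the odd power sums of the points vanish, which makes the points
    symmetric about 0, and eliminating lambda from M_0, M_2, M_4 puts the
    absolute values of the nonzero points on the curve. *)
Require Import Defs.
From mathcomp Require Import all_boot all_order all_algebra.
From mathcomp Require Import all_classical all_reals all_analysis.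
From mathcomp Require Import measurable_realfun zify ring lra.

Set Implicit Arguments.
Unset Strict Implicit.
Unset Printing Implicit Defensive.

Import Order.TTheory GRing.Theory Num.Theory.
Import numFieldNormedType.Exports.

(** * Coprimality, squares and Pythagorean triples of natural numbers *)

Lemma coprime_from_primes a b :
  (forall p, prime p -> p %| a -> p %| b -> False) -> coprime a b.
Proof.
move=> H; rewrite /coprime; apply/negPn/negP => g1.
have pp : prime (pdiv (gcdn a b)).
  (* A zero gcd means a = b = 0, and then the prime 2 divides both. *)
  case: (posnP (gcdn a b)) => [g0|g_gt0]; last first.
    by rewrite pdiv_prime// ltn_neqAle eq_sym g1.
  have a0 : 0 %| a by rewrite -g0 dvdn_gcdl.
  have b0 : 0 %| b by rewrite -g0 dvdn_gcdr.
  by case: (H 2) => //; apply: dvdn_trans (dvdn0 _) _.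
by apply: (H _ pp); apply: dvdn_trans (pdiv_dvd _) _; rewrite ?dvdn_gcdl ?dvdn_gcdr.
Qed.

Lemma coprime_prime_False a b p :
  coprime a b -> prime p -> p %| a -> p %| b -> False.
Proof.
move=> /eqP cab pp pa pb; have : p %| gcdn a b by rewrite dvdn_gcd pa.
by rewrite cab dvdn1 => /eqP p1; rewrite p1 in pp.
Qed.

(** Since c^2 = a b, expanding gcd(a, c)^2 as the gcd of a^2, a c and c^2 leaves a times a gcd that
    divides both a and b, hence is 1. *)
Lemma coprime_mul_sqr a b c :
  coprime a b -> a * b = c ^ 2 -> a = gcdn a c ^ 2.
Proof.
move=> cab abc.
rewrite -mulnn muln_gcdl !muln_gcdr (mulnn c) -abc (mulnC c a) -!muln_gcdr.
rewrite [X in a * X](_ : _ = 1) ?muln1//.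
apply/eqP; rewrite -dvdn1 -(eqP cab) dvdn_gcd.
apply/andP; split; first exact: dvdn_trans (dvdn_gcdl _ _) (dvdn_gcdl _ _).
exact: dvdn_trans (dvdn_gcdr _ _) (dvdn_gcdr _ _).
Qed.

Lemma sqrn_mod4 x : x ^ 2 %% 4 = odd x.
Proof.
rewrite -{1}(odd_double_half x); set k := x./2; case: (odd x) => /=.
  rewrite (_ : _ ^ 2 = 4 * (k * k + k) + 1); last by rewrite -mulnn; lia.
  lia.
rewrite (_ : _ ^ 2 = 4 * (k * k)); last by rewrite -mulnn; lia.
lia.
Qed.

(** Squares are 0 or 1 modulo 4, while two odd squares add up to 2. *)
Lemma odd_leg x y z : x ^ 2 + y ^ 2 = z ^ 2 -> odd x -> ~~ odd y.
Proof.
move: (sqrn_mod4 x) (sqrn_mod4 y) (sqrn_mod4 z).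
move: (x ^ 2) (y ^ 2) (z ^ 2) => X Y Z.
by case: (odd x) (odd y) (odd z) => [] [] []; lia.
Qed.

(** The numbers u = (z + x)/2 and v = (z - x)/2 are coprime with u v = (y/2)^2, hence are squares
    m^2 and n^2. The relation x = m^2 - n^2 is written additively to avoid truncated subtraction. *)
Lemma pythagorean_triple x y z : coprime x y -> odd x -> ~~ odd y ->
  x ^ 2 + y ^ 2 = z ^ 2 ->
  exists m n, [/\ coprime m n, odd (m + n), m ^ 2 = x + n ^ 2,
    y = 2 * (m * n) & z = m ^ 2 + n ^ 2].
Proof.
move=> cxy ox ey e.
have oz : odd z.
  by move: (sqrn_mod4 x) (sqrn_mod4 y) (sqrn_mod4 z); lia.
have lxz : x <= z by rewrite -leq_sqr; lia.
pose u := (z + x)./2; pose v := (z - x)./2.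
have eu : z = u + v by rewrite /u /v; lia.
have ev : u = x + v by rewrite /u /v; lia.
have uv : u * v = y./2 ^ 2.
  have : 4 * (u * v) = 4 * y./2 ^ 2.
    have -> : 4 * y./2 ^ 2 = y ^ 2 by rewrite -!mulnn; nia.
    by move: e; rewrite eu ev -!mulnn; lia.
  lia.
have cuv : coprime u v.
  apply: coprime_from_primes => p pp pu pv.
  have px : p %| x by move: pu; rewrite ev dvdn_addl.
  have py : p %| y.
    have : p %| y ^ 2.
      by rewrite -(dvdn_addr (m := x ^ 2)) ?e ?eu ?dvdn_exp// dvdn_add.
    by rewrite Euclid_dvdX// andbT.
  exact: coprime_prime_False cxy pp px py.
have um := coprime_mul_sqr cuv uv.
have vn : v = gcdn v y./2 ^ 2.
  by apply: (@coprime_mul_sqr v u); rewrite 1?coprime_sym// mulnC.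
set m := gcdn u _ in um; set n := gcdn v _ in vn.
exists m, n; split.
- by move: cuv; rewrite um vn coprime_pexpl// coprime_pexpr.
- by move: oz; rewrite eu um vn !oddD !oddX.
- by rewrite -um -vn.
- have : (m * n) ^ 2 = y./2 ^ 2 by rewrite expnMn -um -vn.
  move=> /eqP; rewrite eqn_exp2r// => /eqP ->; lia.
- by rewrite -um -vn.
Qed.

(** * Fermat's biquadratic equations *)

(** Infinite descent on x. The triple (z, y^2, x^2) gives y^2 = 2 m n and x^2 = m^2 + n^2; with m
    odd, m = r^2 and n = 2 s^2. The triple (m, n, x) gives m = u^2 - v^2 and u v = s^2, so u = p^2,
    v = q^2 and p^4 = q^4 + r^2 with p < x. *)
Lemma fermat_sub_even x y z : coprime x y -> ~~ odd y -> 0 < y ->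
  x ^ 4 = y ^ 4 + z ^ 2 -> False.
Proof.
have [N] := ubnP x; elim: N x y z => // N IHN x y z xN cxy ey y0 e.
have ox : odd x.
  apply: contraT => ex; have : 2 %| gcdn x y by rewrite dvdn_gcd !dvdn2 ex.
  by rewrite (eqP cxy).
have oz : odd z.
  by move: (congr1 odd e); rewrite oddD !oddX ox (negPf ey) /= => <-.
have czy : coprime z (y ^ 2).
  apply: coprime_from_primes => p pp pz; rewrite Euclid_dvdX// andbT => py.
  have : p %| x ^ 4 by rewrite e dvdn_add// dvdn_exp.
  rewrite Euclid_dvdX// andbT => px.
  exact: coprime_prime_False cxy pp px py.
have [||m0 [n0 [cmn0 omn0 _ ey0 ex0]]] := @pythagorean_triple z (y ^ 2) (x ^ 2) czy oz.
- by rewrite oddX.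
- by rewrite -!expnM addnC e.
(* The parameters have opposite parity; [m] names the odd one. *)
have [m [n [cmn om en yE xE]]] : exists m n, [/\ coprime m n, odd m, ~~ odd n,
    y ^ 2 = 2 * (m * n) & x ^ 2 = m ^ 2 + n ^ 2].
  case: (boolP (odd m0)) omn0 => [om|em]; rewrite oddD ?om ?(negPf em) /= => on.
    by exists m0, n0.
  by exists n0, m0; rewrite coprime_sym addnC (mulnC n0).
have mn : m * n./2 = y./2 ^ 2.
  have e1 : y = 2 * y./2 by lia.
  have e2 : n = 2 * n./2 by lia.
  by move: yE; rewrite {1}e1 {1}e2 -!mulnn; lia.
have cmn2 : coprime m n./2.
  by apply: coprime_dvdr cmn; apply/dvdnP; exists 2; lia.
have mr := coprime_mul_sqr cmn2 mn.
have ns : n./2 = gcdn n./2 y./2 ^ 2.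
  by apply: (@coprime_mul_sqr _ m); rewrite 1?coprime_sym// mulnC.
set r := gcdn m _ in mr; set s := gcdn n./2 _ in ns.
have nE : n = 2 * s ^ 2 by rewrite -ns; lia.
have [|u [v [cuv _ ruv suv xuv]]] := @pythagorean_triple m n x cmn om en.
  by rewrite xE.
have s0 : 0 < s by case: (posnP s) nE yE => // -> /= ->; rewrite !muln0; nia.
have suv' : u * v = s ^ 2 by lia.
have up := coprime_mul_sqr cuv suv'.
have vq : v = gcdn v s ^ 2.
  by apply: (@coprime_mul_sqr _ u); rewrite 1?coprime_sym// mulnC.
set p := gcdn u _ in up; set q := gcdn v _ in vq.
have epq : p ^ 4 = q ^ 4 + r ^ 2.
  by rewrite (expnM _ 2 2) (expnM q 2 2) -up -vq -mr addnC.
have or' : odd r by move: om; rewrite mr oddX.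
have q0 : 0 < q.
  by case: (posnP q) vq suv' => // -> ->; rewrite muln0 => /esym/eqP; rewrite expn_eq0; lia.
apply: (IHN p q r) => //.
- rewrite -ltnS; apply: leq_trans xN; rewrite ltnS xuv up vq -!expnM /=.
  rewrite -[p.+1]addn1 leq_add ?expn_gt0 ?q0//.
  by case: (posnP p) => [->//|p0]; rewrite -{1}(expn1 p) leq_pexp2l.
- by move: cuv; rewrite up vq coprime_pexpl// coprime_pexpr.
- have /odd_leg/(_ or') : r ^ 2 + (q ^ 2) ^ 2 = (p ^ 2) ^ 2.
    by rewrite -!expnM epq addnC.
  by rewrite oddX.
Qed.

(** The triple (y^2, z, x^2) gives y^2 = m^2 - n^2 and x^2 = m^2 + n^2, so m^4 = n^4 + (x y)^2 with
    n even. The even case leaves only n = 0, and z = 2 m n. *)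
Lemma fermat_sub_odd x y z : coprime x y -> odd y ->
  x ^ 4 = y ^ 4 + z ^ 2 -> z = 0.
Proof.
move=> cxy oy e.
have ez : ~~ odd z.
  apply: (@odd_leg (y ^ 2) z (x ^ 2)); last by rewrite oddX.
  by rewrite -!expnM e.
have cyz : coprime (y ^ 2) z.
  apply: coprime_from_primes => p pp; rewrite Euclid_dvdX// andbT => py pz.
  have : p %| x ^ 4 by rewrite e dvdn_add// dvdn_exp.
  rewrite Euclid_dvdX// andbT => px.
  exact: coprime_prime_False cxy pp px py.
have [||m [n [cmn omn ey0 ez0 ex0]]] := @pythagorean_triple (y ^ 2) z (x ^ 2) cyz _ ez.
- by rewrite oddX.
- by rewrite -!expnM e.
have en : ~~ odd n.
  by apply: (@odd_leg y n m); rewrite ?ey0.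
case: (posnP n) => n0; first by rewrite ez0 n0 !muln0.
exfalso; apply: (@fermat_sub_even m n (x * y)) => //.
rewrite expnMn ex0 (expnM m 2 2) (expnM n 2 2) ey0; nia.
Qed.

(** With z = (a^4 - b^4)/2 and c^2 = (a^4 + b^4)/2, one has c^4 - z^2 = (a b)^4. As a b is odd, the
    difference equation forces z = 0. *)
Lemma biquadratic_double_square a b c : coprime a b -> odd a -> odd b ->
  a ^ 4 + b ^ 4 = 2 * c ^ 2 -> a = b.
Proof.
wlog ba : a b / b <= a => [H cab oa ob e|cab oa ob e].
  case/orP: (leq_total b a) => h; first exact: H.
  by apply/esym/H; rewrite 1?coprime_sym// addnC.
have ba4 : b ^ 4 <= a ^ 4 by rewrite leq_exp2r.
have ab4 : odd (a ^ 4) && odd (b ^ 4) by rewrite !oddX oa ob.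
pose z := (a ^ 4 - b ^ 4)./2.
have az : a ^ 4 = b ^ 4 + 2 * z by rewrite /z; lia.
suff : z = 0 by move=> z0; apply/eqP; rewrite -(@eqn_exp2r _ _ 4)//; lia.
apply: (@fermat_sub_odd c (a * b)).
- apply: coprime_from_primes => p pp pc.
  have p4 : p %| a ^ 4 + b ^ 4 by rewrite e dvdn_mull// dvdn_exp.
  move=> pab; have [pa pb] : p %| a /\ p %| b.
    move: pab p4; rewrite Euclid_dvdM// => /orP[] h.
      by rewrite (dvdn_addr _ (dvdn_exp _ h))// Euclid_dvdX// andbT.
    by rewrite (dvdn_addl _ (dvdn_exp _ h))// Euclid_dvdX// andbT.
  exact: coprime_prime_False cab pp pa pb.
- by rewrite oddM oa ob.
- have cE : c ^ 2 = b ^ 4 + z by lia.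
  by rewrite (expnM c 2 2) cE expnMn az; nia.
Qed.

(** Infinite descent on z. For x odd and y nonzero, x^2 = m^2 - n^2, y^2 = 2 m n and z = m^2 + n^2;
    the triple (x, n, m) gives n = 2 r s and m = r^2 + s^2. The pairwise coprime r, s, m have
    product (y/2)^2, so all three are squares, and m = g^2 is a smaller solution; its zero product
    would make n vanish. *)
Lemma biquadratic_sum_square x y z : coprime x y ->
  x ^ 4 + y ^ 4 = z ^ 2 -> x * y = 0.
Proof.
have [N] := ubnP z; elim: N x y z => // N IHN x y z.
wlog ox : x y / odd x => [H zN cxy e|].
  case: (boolP (odd x)) => ox; first exact: H ox zN cxy e.
  rewrite mulnC; apply: H => //; last 1 first.
  - by rewrite addnC.
  - apply: contraT => oy; have : 2 %| gcdn x y by rewrite dvdn_gcd !dvdn2 ox.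
    by rewrite (eqP cxy).
  - by rewrite coprime_sym.
move=> zN cxy e; case: (posnP y) => [->|y0]; first by rewrite muln0.
exfalso.
have ey : ~~ odd y.
  have /odd_leg : (x ^ 2) ^ 2 + (y ^ 2) ^ 2 = z ^ 2 by rewrite -!expnM.
  by rewrite !oddX; apply.
have [||||m [n [cmn omn xE yE zE]]] := @pythagorean_triple (x ^ 2) (y ^ 2) z.
- by rewrite coprime_pexpl// coprime_pexpr.
- by rewrite oddX.
- by rewrite oddX.
- by rewrite -!expnM.
have en : ~~ odd n.
  by apply: (@odd_leg x n m); rewrite ?xE.
have n0 : 0 < n by case: (posnP n) yE => // ->; rewrite !muln0; nia.
have cxn : coprime x n.
  apply: coprime_from_primes => p pp px pn; apply: (coprime_prime_False cmn pp _ pn).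
  have : p %| m ^ 2 by rewrite xE dvdn_add// dvdn_exp.
  by rewrite Euclid_dvdX// andbT.
have [|r [s [crs _ _ nE mE]]] := @pythagorean_triple x n m cxn ox en.
  by rewrite -xE.
have yrs : (r * s) * m = y./2 ^ 2.
  have e1 : y = 2 * y./2 by lia.
  by move: yE; rewrite {1}e1 nE -!mulnn; nia.
have crsm : coprime (r * s) m.
  by rewrite coprime_sym; apply: coprime_dvdr cmn; rewrite nE dvdn_mull.
have mg : m = gcdn m y./2 ^ 2.
  by apply: (@coprime_mul_sqr _ (r * s)); rewrite 1?coprime_sym// mulnC.
have rsg := coprime_mul_sqr crsm yrs.
have ra := coprime_mul_sqr crs rsg.
have sb : s = gcdn s (gcdn (r * s) y./2) ^ 2.
  by apply: (@coprime_mul_sqr _ r); rewrite 1?coprime_sym// mulnC.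
set g := gcdn m _ in mg; set al := gcdn r _ in ra; set be := gcdn s _ in sb.
have g0 : 0 < g.
  by rewrite -(ltn_exp2r 0 g (isT : 0 < 2)) -mg -(ltn_exp2r 0 m (isT : 0 < 2))
    xE ltn_addl// expn_gt0 n0.
have /eqP : al * be = 0.
  apply: (IHN _ _ g).
  - rewrite -ltnS; apply: leq_trans zN; rewrite ltnS zE mg -expnM.
    rewrite -[g.+1]addn1 leq_add ?expn_gt0 ?n0//.
    by rewrite -{1}(expn1 g) leq_pexp2l.
  - by move: crs; rewrite ra sb coprime_pexpl// coprime_pexpr.
  - by rewrite -mg mE (expnM al 2 2) (expnM be 2 2) -ra -sb.
rewrite muln_eq0 => /orP[] /eqP h; move: n0; rewrite nE.
  by rewrite ra h mul0n.
by rewrite sb h !muln0.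
Qed.

(** * The rational points of the two curves *)

(** A prime p dividing Q divides neither a nor b. Modulo a^4 + b^4, the square of a^2 + b^2 is 2 (a
    b)^2 and the quartic factor is m (a b)^2, so a common p would be 2 or 3. Oddness of Q excludes
    2; fourth powers being 0 or 1 modulo 3 excludes 3. *)
Lemma coprime_biquadratic_cofactor a b Q m : coprime a b -> odd Q ->
  Q %| a ^ 4 + b ^ 4 -> 0 < m -> m %| 12 ->
  coprime Q ((a ^ 2 + b ^ 2) * (a ^ 4 + m * (a * b) ^ 2 + b ^ 4)).
Proof.
move=> cab oQ Qab m0 m12; apply: coprime_from_primes => p pp pQ.
have pab := dvdn_trans pQ Qab.
have p2 : p != 2 by apply: contraL oQ => /eqP p2; rewrite -dvdn2 -p2.
have p3 : p != 3.
  apply/eqP => p3; move: pab (coprime_prime_False cab pp); rewrite p3.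
  rewrite /dvdn -modnDm -(modnXm 4 3 a) -(modnXm 4 3 b).
  move: (ltn_pmod a (isT : 0 < 3)) (ltn_pmod b (isT : 0 < 3)).
  by case: (a %% 3) => [|[|[|]]] //; case: (b %% 3) => [|[|[|]]] // _ _ _; apply.
have npab : ~~ (p %| (a * b) ^ 2).
  rewrite Euclid_dvdX// andbT Euclid_dvdM//; apply/negP => /orP[] h.
    apply: (coprime_prime_False cab pp h).
    by move: pab; rewrite (dvdn_addr _ (dvdn_exp _ h))// Euclid_dvdX// andbT.
  apply: (coprime_prime_False cab pp _ h).
  by move: pab; rewrite (dvdn_addl _ (dvdn_exp _ h))// Euclid_dvdX// andbT.
rewrite Euclid_dvdM// => /orP[] h.
  have : p %| a ^ 4 + b ^ 4 + 2 * (a * b) ^ 2.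
    rewrite (_ : _ + _ = (a ^ 2 + b ^ 2) ^ 2) ?dvdn_exp//.
    by rewrite sqrnD expnMn -!expnM.
  by rewrite dvdn_addr// Euclid_dvdM// (negPf npab) orbF dvdn_prime2// (negPf p2).
move: h; rewrite addnAC dvdn_addr// Euclid_dvdM// (negPf npab) orbF => pm.
have : p %| 12 by apply: dvdn_trans pm m12.
rewrite (_ : 12 = 2 ^ 2 * 3)// Euclid_dvdM// Euclid_dvdX// andbT.
by rewrite !dvdn_prime2// (negPf p2) (negPf p3).
Qed.

Lemma odd_sqrnE x : odd x -> exists k, x ^ 2 = 8 * k + 1.
Proof.
move=> ox; pose j := x./2; have -> : x = 2 * j + 1 by rewrite /j; lia.
have [t jE] : exists t, j * (j + 1) = 2 * t.
  by exists (j * (j + 1))./2; move: (oddM j (j + 1)); rewrite oddD addbT andbN; lia.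
by exists t; rewrite -mulnn; lia.
Qed.

(** Halving k shows that the product of the three forms is even, which forces a and b odd. Odd
    fourth powers are 1 modulo 8, so Q = (a^4 + b^4)/2 is odd; being coprime to the other factors,
    it is a square. *)
Lemma form6_square a b k : coprime a b ->
  2 * (a ^ 4 + b ^ 4) * ((a ^ 2 + b ^ 2) * (a ^ 4 + 6 * (a * b) ^ 2 + b ^ 4))
    = k ^ 2 ->
  a = 1 /\ b = 1.
Proof.
move=> cab e.
have ek : ~~ odd k by move: (congr1 odd e); rewrite oddX -mulnA oddM /= => <-.
pose j := k./2; have kE : k = 2 * j by rewrite mul2n even_halfK.
have e2 : (a ^ 4 + b ^ 4) * ((a ^ 2 + b ^ 2) * (a ^ 4 + 6 * (a * b) ^ 2 + b ^ 4))
    = 2 * j ^ 2.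
  have jE : (2 * j) ^ 2 = 2 * (2 * j ^ 2) by rewrite expnMn mulnA.
  by move/eqP: e; rewrite -mulnA kE jE eqn_pmul2l// => /eqP.
have [oa ob] : odd a /\ odd b.
  move: (congr1 odd e2); rewrite !(oddM, oddD) /=.
  case: (boolP (odd a)) (boolP (odd b)) => oa [] ob //=.
  have := coprime_prime_False cab (isT : prime 2).
  by rewrite !dvdn2 oa ob => /(_ isT isT).
pose Q := (a ^ 4 + b ^ 4)./2.
have [s aE] := odd_sqrnE oa; have [t bE] := odd_sqrnE ob.
have QE : a ^ 4 + b ^ 4 = 2 * Q.
  by rewrite /Q; move: (oddX a 4) (oddX b 4); rewrite oa ob /=; clear; lia.
have oQ : odd Q.
  by move: QE; rewrite (expnM a 2 2) (expnM b 2 2) aE bE -!mulnn; clear; lia.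
have eQ : Q * ((a ^ 2 + b ^ 2) * (a ^ 4 + 6 * (a * b) ^ 2 + b ^ 4)) = j ^ 2.
  by move/eqP: e2; rewrite QE -mulnA eqn_pmul2l// => /eqP.
have cQ : coprime Q ((a ^ 2 + b ^ 2) * (a ^ 4 + 6 * (a * b) ^ 2 + b ^ 4)).
  by apply: coprime_biquadratic_cofactor => //; rewrite QE dvdn_mull.
have Qc := coprime_mul_sqr cQ eQ.
have ab : a = b.
  by apply: (biquadratic_double_square cab oa ob (c := gcdn Q j)); rewrite -Qc.
by move: cab; rewrite -ab /coprime gcdnn => /eqP.
Qed.

Lemma form12_square a b k : coprime a b ->
  (a ^ 4 + b ^ 4) * ((a ^ 2 + b ^ 2) * (a ^ 4 + 12 * (a * b) ^ 2 + b ^ 4))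
    = k ^ 2 ->
  a * b = 0.
Proof.
move=> cab e; case: (boolP (odd (a ^ 4 + b ^ 4))) => o.
  have cQ : coprime (a ^ 4 + b ^ 4)
      ((a ^ 2 + b ^ 2) * (a ^ 4 + 12 * (a * b) ^ 2 + b ^ 4)).
    exact: coprime_biquadratic_cofactor.
  exact: biquadratic_sum_square cab (coprime_mul_sqr cQ e).
exfalso; have [oa ob] : odd a /\ odd b.
  move: o; rewrite oddD !oddX /=.
  case: (boolP (odd a)) (boolP (odd b)) => oa [] ob //=.
  have := coprime_prime_False cab (isT : prime 2).
  by rewrite !dvdn2 oa ob => /(_ isT isT).
(* For a and b odd each of the three factors is twice an odd number, so the product is 8 times an
   odd number and no square. *)
have [s aE] := odd_sqrnE oa; have [t bE] := odd_sqrnE ob.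
have [u uE] : exists u, a ^ 4 + b ^ 4 = 2 * (2 * u + 1).
  exists (16 * s ^ 2 + 4 * s + 16 * t ^ 2 + 4 * t).
  by rewrite (expnM a 2 2) (expnM b 2 2) aE bE -!mulnn; clear; lia.
have [v vE] : exists v, a ^ 2 + b ^ 2 = 2 * (2 * v + 1).
  by exists (2 * s + 2 * t); rewrite aE bE; clear; lia.
have [w wE] : exists w, a ^ 4 + 12 * (a * b) ^ 2 + b ^ 4 = 2 * (2 * w + 1).
  exists (u + 3 * (a * b) ^ 2); rewrite addnAC uE; clear; lia.
move: e; rewrite uE vE wE => e.
have ek : ~~ odd k by move: (congr1 odd e); rewrite oddX -mulnA oddM /= => <-.
pose j := k./2; have kE : k = 2 * j by rewrite mul2n even_halfK.
have e2 : 2 * ((2 * u + 1) * ((2 * v + 1) * (2 * w + 1))) = j ^ 2.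
  by move: e; rewrite kE -!mulnn; clear; lia.
move: (sqrn_mod4 j); rewrite -e2.
have : odd ((2 * u + 1) * ((2 * v + 1) * (2 * w + 1))).
  by rewrite !(oddM, oddD).
by move: (_ * (_ * _)) (odd j) => X []; clear; lia.
Qed.

Local Open Scope classical_set_scope.
Local Open Scope ring_scope.

(** * From rational points to coprime pairs of natural numbers *)

Lemma rat_sqr_nat (q : rat) (n : nat) : q ^+ 2 = n%:R -> exists k, n = (k ^ 2)%N.
Proof.
move=> qn.
have e : (`|numq q| ^ 2 = n * `|denq q| ^ 2)%N.
  apply/eqP; rewrite -(eqr_nat rat) natrM !natrX !natr_absz -qn.
  rewrite !intr_norm !real_normK ?num_real// -exprMn -{2}(divq_num_den q).
  by rewrite divfK// intr_eq0 denq_neq0.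
have : (`|denq q| ^ 2 %| `|numq q| ^ 2)%N by rewrite e dvdn_mull.
rewrite dvdn_pexp2r// => /dvdnP[t tE]; exists t.
apply/eqP; rewrite -(@eqn_pmul2r (`|denq q| ^ 2)) ?expn_gt0 ?absz_gt0 ?denq_neq0//.
by rewrite -e tE expnMn.
Qed.

(** Absolute values suffice because both curves involve only even powers of the coordinates. *)
Lemma rat_pair_primitive (x y : rat) : (x, y) != (0, 0) ->
  exists r : rat, exists a b : nat,
    [/\ coprime a b, r != 0, `|x| = r * a%:R & `|y| = r * b%:R].
Proof.
move=> xy0.
have normE (z : rat) : `|z| = `|numq z|%:R / `|denq z|%:R.
  by rewrite !natr_absz !intr_norm -normf_div divq_num_den.
have den0 (z : rat) : `|denq z|%:R != 0 :> rat.
  by rewrite pnatr_eq0 absz_eq0 denq_neq0.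
pose A := (`|numq x| * `|denq y|)%N; pose B := (`|numq y| * `|denq x|)%N.
have g0 : (0 < gcdn A B)%N.
  rewrite gcdn_gt0 !muln_gt0 !absz_gt0 !denq_neq0 !andbT !numq_eq0 -negb_and.
  by rewrite -xpair_eqE.
exists ((gcdn A B)%:R / (`|denq x|%:R * `|denq y|%:R)).
exists (A %/ gcdn A B)%N, (B %/ gcdn A B)%N; split.
- by rewrite /coprime -(eqn_pmul2r g0) muln_gcdl !divnK ?dvdn_gcdl ?dvdn_gcdr// mul1n.
- by rewrite mulf_neq0 ?invr_eq0 ?mulf_neq0// pnatr_eq0 -lt0n.
- rewrite mulrAC -(natrM _ (gcdn A B)) (mulnC (gcdn A B)) divnK ?dvdn_gcdl// natrM normE.
  by field; rewrite !den0.
- rewrite mulrAC -(natrM _ (gcdn A B)) (mulnC (gcdn A B)) divnK ?dvdn_gcdr// natrM normE.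
  by field; rewrite !den0.
Qed.

Lemma gegenbauer4_curve (x1 x2 : rat) :
  2 * (x1 ^+ 4 + x2 ^+ 4) * (x1 ^+ 2 + x2 ^+ 2 + 1)
    = 3 * (x1 ^+ 2 + x2 ^+ 2) ^+ 2
  <-> (x1, x2) \in [:: (-1, -1); (-1, 1); (0, 0); (1, -1); (1, 1)].
Proof.
split; last first.
  by rewrite !inE => /or4P[|||/orP[]] /eqP[-> ->].
move=> e; have [->//|xy0] := eqVneq (x1, x2) (0, 0).
have [r [a [b [cab r0 x1E x2E]]]] := rat_pair_primitive xy0.
have x1S : x1 ^+ 2 = r ^+ 2 * a%:R ^+ 2 by rewrite -exprMn -x1E real_normK ?num_real.
have x2S : x2 ^+ 2 = r ^+ 2 * b%:R ^+ 2 by rewrite -exprMn -x2E real_normK ?num_real.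
(* The curve equation divided by r^4 and solved for the term in r^2. *)
have e1 : 2 * (a%:R ^+ 4 + b%:R ^+ 4) * (a%:R ^+ 2 + b%:R ^+ 2) * r ^+ 2
    = a%:R ^+ 4 + 6 * (a%:R * b%:R) ^+ 2 + b%:R ^+ 4.
  move: e; rewrite (exprM x1 2 2) (exprM x2 2 2) x1S x2S => e.
  apply: (mulfI (expf_neq0 4 r0)); lra.
(* Multiplying [e1] by the coefficient of r^2 makes its left side the square of that coefficient
   times r. *)
have [k kE] : exists k, (2 * (a ^ 4 + b ^ 4) *
    ((a ^ 2 + b ^ 2) * (a ^ 4 + 6 * (a * b) ^ 2 + b ^ 4)) = k ^ 2)%N.
  apply: (@rat_sqr_nat (2 * (a%:R ^+ 4 + b%:R ^+ 4) * (a%:R ^+ 2 + b%:R ^+ 2) * r)).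
  rewrite !(natrM, natrD, natrX) -e1; ring.
have [a1 b1] := form6_square cab kE.
have r2 : r ^+ 2 = 1 by move: e1; rewrite a1 b1; lra.
rewrite a1 b1 r2 !(expr1n, mulr1) in x1S x2S.
by move/eqP: x1S; move/eqP: x2S; rewrite !sqrf_eq1 => /orP[] /eqP -> /orP[] /eqP ->.
Qed.

Lemma gegenbauer5_curve (x1 x2 : rat) :
  (x1 ^+ 4 + x2 ^+ 4) * (4 * x1 ^+ 2 + 4 * x2 ^+ 2 + 5)
    = 6 * (x1 ^+ 2 + x2 ^+ 2) ^+ 2
  <-> (x1, x2) \in [:: (- 2^-1, 0); (0, - 2^-1); (0, 0); (0, 2^-1); (2^-1, 0)].
Proof.
split; last first.
  by rewrite !inE => /or4P[|||/orP[]] /eqP[-> ->].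
move=> e; have [->//|xy0] := eqVneq (x1, x2) (0, 0).
have [r [a [b [cab r0 x1E x2E]]]] := rat_pair_primitive xy0.
have x1S : x1 ^+ 2 = r ^+ 2 * a%:R ^+ 2 by rewrite -exprMn -x1E real_normK ?num_real.
have x2S : x2 ^+ 2 = r ^+ 2 * b%:R ^+ 2 by rewrite -exprMn -x2E real_normK ?num_real.
have e1 : 4 * (a%:R ^+ 4 + b%:R ^+ 4) * (a%:R ^+ 2 + b%:R ^+ 2) * r ^+ 2
    = a%:R ^+ 4 + 12 * (a%:R * b%:R) ^+ 2 + b%:R ^+ 4.
  move: e; rewrite (exprM x1 2 2) (exprM x2 2 2) x1S x2S => e.
  apply: (mulfI (expf_neq0 4 r0)); lra.
(* Multiplying [e1] by (a^4 + b^4)(a^2 + b^2) suffices here, as the remaining factor 4 is a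
   square. *)
have [k kE] : exists k, ((a ^ 4 + b ^ 4) *
    ((a ^ 2 + b ^ 2) * (a ^ 4 + 12 * (a * b) ^ 2 + b ^ 4)) = k ^ 2)%N.
  apply: (@rat_sqr_nat (2 * (a%:R ^+ 4 + b%:R ^+ 4) * (a%:R ^+ 2 + b%:R ^+ 2) * r)).
  rewrite !(natrM, natrD, natrX) -e1; ring.
have /eqP := form12_square cab kE.
have half (z : rat) : z ^+ 2 = (2^-1) ^+ 2 -> z = 2^-1 \/ z = - 2^-1.
  by move/eqP; rewrite eqf_sqr => /orP[] /eqP; [left | right].
rewrite muln_eq0 => /orP[] /eqP c0; rewrite c0 in cab x1E x2E e1.
- have b1 : b = 1%N by move: cab; rewrite /coprime gcd0n => /eqP.
  move: x1E => /eqP; rewrite mulr0 normr_eq0 => /eqP ->.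
  have : x2 ^+ 2 = (2^-1) ^+ 2 by rewrite x2S b1; move: e1; rewrite b1; lra.
  by case/half => ->.
- have a1 : a = 1%N by move: cab; rewrite /coprime gcdn0 => /eqP.
  move: x2E => /eqP; rewrite mulr0 normr_eq0 => /eqP ->.
  have : x1 ^+ 2 = (2^-1) ^+ 2 by rewrite x1S a1; move: e1; rewrite a1; lra.
  by case/half => ->.
Qed.

(** * Moments of the Gegenbauer measure *)

(** The fundamental theorem of calculus on growing compact subintervals, followed by dominated
    convergence with bound |h|. It allows h to be unbounded at the endpoints. *)
Lemma integral_derive_oo_eq0 (R : realType) (F h : R -> R) :
  (forall t : R, -1 < t < 1 -> is_derive t 1 F (h t)) ->
  (forall t : R, -1 < t < 1 -> {for t, continuous h}) ->
  lebesgue_measure.-integrable `]-1, 1[ (EFin \o h) ->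
  F (1 - u) @[u --> 0^'+] --> (0 : R) -> F (- (1 - u)) @[u --> 0^'+] --> (0 : R) ->
  (\int[lebesgue_measure]_(t in `](-1)%R, 1%R[) (h t)%:E = 0)%E.
Proof.
move=> dF ch ih F1 FN1.
(* Starting the margins at 1/2 makes every interval [I n] nondegenerate. *)
pose u n : R := n.+2%:R^-1; pose I n := `[- (1 - u n), 1 - u n]%classic.
have u0 n : 0 < u n by rewrite invr_gt0.
have u12 n : u n <= 2^-1 by rewrite lef_pV2 ?posrE// ler_nat.
have ucvg : u n @[n --> \oo] --> 0.
  rewrite /u; have := @cvg_harmonic R; rewrite -(cvg_shiftn 1).
  by under eq_fun do rewrite addn1.
have sub n t : I n t -> -1 < t < 1.
  rewrite /I/= in_itv/= => /andP[t1 t2]; have := u0 n; lra.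
have FTC n : (\int[lebesgue_measure]_(t in `](-1)%R, 1%R[) ((EFin \o h) \_ (I n)) t
    = (F (1 - u n) - F (- (1 - u n)))%:E)%E.
  rewrite -integral_mkcondr setIidr; last first.
    by move=> t /sub; rewrite /= in_itv.
  have cF t : I n t -> {for t, continuous F}.
    move=> /sub /dF [dFt _].
    by apply: differentiable_continuous; apply/derivable1_diffP.
  rewrite EFinB; apply: continuous_FTC2.
  - by have := u12 n; lra.
  - by apply: continuous_in_subspaceT => t; rewrite inE => /sub; exact: ch.
  - split.
    + move=> t tI; have /sub/dF[//] : I n t.
      by move: tI; rewrite /I/= !in_itv/= => /andP[t1 t2]; rewrite !ltW.
    + apply: cvg_at_right_filter; apply: cF; rewrite /I/= in_itv/= lexx.
      by have := u12 n; lra.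
    + apply: cvg_at_left_filter; apply: cF; rewrite /I/= in_itv/= lexx.
      by have := u12 n; lra.
  - move=> t tI; have /sub/dF dFt : I n t.
      by move: tI; rewrite /I/= !in_itv/= => /andP[t1 t2]; rewrite !ltW.
    by rewrite derive1E derive_val.
have lim0 : (F (1 - u n) - F (- (1 - u n)))%:E @[n --> \oo] --> 0%E.
  apply: cvg_EFin; first exact: nearW.
  rewrite -(subr0 0); apply: cvgB.
    by move/cvg_at_rightP: F1; apply.
  by move/cvg_at_rightP: FN1; apply.
have mh := measurable_int _ ih.
have [] := @dominated_convergence _ _ _ (@lebesgue_measure R) `]-1, 1[ (measurable_itv _)
  (fun n => (EFin \o h) \_ (I n)) (EFin \o h) (abse \o (EFin \o h)).
- move=> n; apply/measurable_restrict => //.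
    exact: measurable_itv.
  by apply: (measurable_funS _ _ mh) => // t [].
- exact: mh.
- apply/aeW => t; rewrite /= in_itv/= => /andP[t1 t2].
  apply: cvg_near_cst.
  (* From such an n on, t lies in [I n], so the truncated functions are eventually constant at t. *)
  have : \forall n \near \oo, u n < Num.min (1 - t) (1 + t).
    move/cvgrPdist_lt: ucvg => /(_ (Num.min (1 - t) (1 + t))).
    have h0 : 0 < Num.min (1 - t) (1 + t) by rewrite lt_min; lra.
    move=> /(_ h0); apply: filterS => n; rewrite sub0r normrN ger0_norm//.
    exact: ltW.
  apply: filterS => n; rewrite lt_min => /andP[h1 h2].
  by rewrite patchE mem_set// /I/= in_itv/=; lra.
- exact: integrable_abse.
- apply/aeW => t n _; rewrite patchE; case: ifP => // _.
  by rewrite abse0 abse_ge0.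
move=> _ _.
rewrite (funext FTC) => /cvg_lim <- //; exact/cvg_lim.
Qed.

Lemma norm_horner_le (R : realDomainType) (p : {poly R}) (t : R) :
  `|t| <= 1 -> `|p.[t]| <= \sum_(i < size p) `|p`_i|.
Proof.
move=> t1; rewrite horner_coef; apply: le_trans (ler_norm_sum _ _ _) _.
apply: ler_sum => i _; rewrite normrM normrX ler_piMr// exprn_ile1//.
Qed.

(** The integrand is the derivative of p(t) (1 - t^2)^(lambda + 1/2), up to the normalising
    constant. The exponent is positive, so the boundary values vanish. *)
Lemma integral_gegenbauer_eq0 (R : realType) (lambda : R) (p : {poly R}) :
  - 2^-1 < lambda ->
  lebesgue_measure.-integrable `]-1, 1[ (EFin \o gegenbauer_density lambda) ->
  (\int[lebesgue_measure]_(t in `](-1)%R, 1%R[)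
    ((p^`() * (1 - 'X^2) - (2 * lambda + 1) *: ('X * p)).[t]
      * gegenbauer_density lambda t)%:E = 0)%E.
Proof.
move=> l_gt id.
set q := p^`() * (1 - 'X^2) - _.
pose mu := lambda + 2^-1.
have mu_gt0 : 0 < mu by rewrite /mu; lra.
set c := (\int[lebesgue_measure]_(s in `]-1, 1[) gegenbauer_weight lambda s)^-1.
have dE t : gegenbauer_density lambda t = (1 - t ^+ 2) `^ (mu - 1) * c.
  rewrite /gegenbauer_density /gegenbauer_weight /c /mu.
  by congr (_ `^ _ / _); lra.
have base_gt0 (t : R) : -1 < t < 1 -> 0 < 1 - t ^+ 2 by nra.
have dbase (t a : R) : -1 < t < 1 ->
    is_derive t 1 (fun t => (1 - t ^+ 2) `^ a)
      (a * (1 - t ^+ 2) `^ (a - 1) * (- (2 * t))).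
  move=> t1.
  have h : is_derive t 1 (fun t : R => 1 - t ^+ 2) (- (2 * t)).
    apply: is_derive_eq; rewrite /GRing.scale/=; ring.
  by apply: (@is_derive1_comp R (fun x => x `^ a) (fun t => 1 - t ^+ 2) t _ _
    (is_derive1_powR a (base_gt0 _ t1)) h).
pose F t := p.[t] * (1 - t ^+ 2) `^ mu * c.
have F_bnd t : -1 < t < 1 ->
    `|F t| <= (\sum_(i < size p) `|p`_i|) * `|c| * (1 - t ^+ 2) `^ mu.
  move=> t1; rewrite /F !normrM (ger0_norm (powR_ge0 _ _)) mulrAC.
  by rewrite ler_wpM2r ?powR_ge0// ler_wpM2r// norm_horner_le// ler_norml; lra.
(* Both endpoints at once: for s u = 1 - u and for its opposite, 1 - (s u)^2 = u (2 - u) <= 2 u, so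
   F is bounded by a multiple of u^mu. *)
have powR_lim (s : R -> R) : (forall u, 0 < u < 1 -> 1 - s u ^+ 2 = u * (2 - u)) ->
    (forall u, 0 < u < 1 -> -1 < s u < 1) ->
    F (s u) @[u --> 0^'+] --> (0 : R).
  move=> sE s1.
  have lim0 : (\sum_(i < size p) `|p`_i|) * `|c| * (2 `^ mu * u `^ mu)
      @[u --> 0^'+] --> (0 : R).
    rewrite -[X in _ --> X](mulr0 ((\sum_(i < size p) `|p`_i|) * `|c|)).
    apply: cvgM; first exact: cvg_cst.
    rewrite -[X in _ --> X](mulr0 (2 `^ mu)); apply: cvgM; first exact: cvg_cst.
    exact: powR_cvg0.
  apply/norm_cvg0P; apply: (squeeze_cvgr _ (cvg_cst 0) lim0).
  near=> u.
  have u01 : 0 < u < 1.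
    by apply/andP; split; near: u; [exact: nbhs_right_gt|exact: nbhs_right_lt].
  rewrite normr_ge0/=; apply: le_trans (F_bnd _ (s1 _ u01)) _.
  rewrite ler_wpM2l ?mulr_ge0 ?sumr_ge0// sE// mulrC powRM; [|lra|lra].
  rewrite ler_wpM2r ?powR_ge0//; apply: ge0_ler_powR; rewrite ?nnegrE; lra.
apply: (@integral_derive_oo_eq0 R F).
- move=> t t1; rewrite dE.
  have -> : q.[t] * ((1 - t ^+ 2) `^ (mu - 1) * c) =
    (p.[t] * (mu * (1 - t ^+ 2) `^ (mu - 1) * - (2 * t)) +
     (1 - t ^+ 2) `^ mu * p^`().[t]) * c.
    rewrite -(@mulr_powRB1 _ (1 - t ^+ 2) mu) ?ltW ?base_gt0//.
    by rewrite /q /mu !hornerE/=; field.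
  have dpt := is_derive_poly p t.
  have dbt := dbase t mu t1.
  rewrite /F; apply: is_derive_eq; rewrite /GRing.scale/=; ring.
- move=> t t1; apply: cvgM; first exact: continuous_horner.
  have [d _] := dbase t (mu - 1) t1.
  have /differentiable_continuous :
      differentiable (fun t : R => (1 - t ^+ 2) `^ (mu - 1)) t.
    exact/derivable1_diffP.
  move=> h; rewrite dE (_ : gegenbauer_density lambda =
    (fun t => (1 - t ^+ 2) `^ (mu - 1) * c)).
    by apply: cvgM => //; exact: cvg_cst.
  by apply/funext.
- have /integrableP[md _] := id.
  (* [M] bounds |q| on the interval, so M times the density dominates the integrand. *)
  set M := \sum_(i < size q) `|q`_i|.
  have := @integrableZl _ _ R (@lebesgue_measure R) `]-1, 1[ (measurable_itv _) M _ id.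
  apply: le_integrable => //.
    apply/measurable_EFinP; apply: measurable_funM; first exact: measurable_poly.
    exact/measurable_EFinP.
  move=> t; rewrite /= in_itv/= => t1.
  rewrite lee_fin !normrM ler_wpM2r//.
  apply: le_trans (norm_horner_le _ _) (ler_norm _).
  by rewrite ler_norml; lra.
- by apply: powR_lim => u; lra.
- by apply: powR_lim => u; lra.
Unshelve. all: end_near. Qed.

Lemma gegenbauer_density_ge0 (R : realType) (lambda t : R) :
  0 <= gegenbauer_density lambda t.
Proof.
rewrite /gegenbauer_density divr_ge0 ?powR_ge0//.
by apply: Rintegral_ge0 => // s _; exact: powR_ge0.
Qed.

Lemma measurable_gegenbauer_density (R : realType) (lambda : R) (A : set R) :
  measurable_fun A (gegenbauer_density lambda).
Proof.
apply: measurable_funM => //; apply: measurable_funTS.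
apply: (@measurableT_comp _ _ _ _ _ _ (@powR R ^~ (lambda - 2^-1))) => //.
by apply: measurable_funB => //; exact: measurable_funX.
Qed.

(** * Power sums of the points of a design *)

Section design_power_sums.
Variables (R : realType) (n : nat) (lambda : R) (x : 'I_n.+1 -> R).
Hypothesis lambda_gt : - 2^-1 < lambda.
Hypothesis design : is_design 5 `]-1, 1[ (gegenbauer_density lambda) x.

Let s k := \sum_(i < n.+1) x i ^+ k.

(* No Beta-integral estimate is needed: the quadrature identity for the constant
   polynomial 1 already forces the integral of the density to be finite. *)
Lemma design_integrable :
  lebesgue_measure.-integrable `]-1, 1[ (EFin \o gegenbauer_density lambda).
Proof.
apply/integrableP; split.
  by apply/measurable_EFinP; exact: measurable_gegenbauer_density.
have [_ _ /(_ 1)] := design; rewrite size_poly1 => /(_ isT) e.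
under eq_integral => t _.
  rewrite /= ger0_norm ?gegenbauer_density_ge0//.
  rewrite -[gegenbauer_density _ _]mul1r -(hornerC 1 t).
  over.
by rewrite /= -e ltry.
Qed.

(** The quadrature identity for the polynomial of vanishing integral attached to p = X^k; its degree
    is at most k + 1, whence k <= 4. At k = 0 the truncated index [k.-1] carries the coefficient
    0. *)
Lemma design_power_sum_rec k : (k <= 4)%N ->
  k%:R * s k.-1 = (k%:R + 2 * lambda + 1) * s k.+1.
Proof.
move=> k4.
pose f : {poly R} := ('X^k)^`() * (1 - 'X^2) - (2 * lambda + 1) *: ('X * 'X^k).
have [_ _ /(_ f)] := design.
rewrite (integral_gegenbauer_eq0 _ lambda_gt design_integrable).
have sz : (size f <= 6)%N.
  rewrite /f -exprS derivXn.
  apply: leq_trans (size_polyD _ _) _; rewrite size_polyN geq_max; apply/andP; split.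
    apply: leq_trans (size_polyMleq _ _) _.
    have h1 : (size ('X^(k.-1) *+ k : {poly R})%R <= k.-1.+1)%N.
      by rewrite -scaler_nat (leq_trans (size_scale_leq _ _))// size_polyXn.
    have h2 : (size (1 - 'X^2 : {poly R})%R <= 3)%N.
      by rewrite (leq_trans (size_polyD _ _))// size_polyN size_polyXn size_poly1.
    by move: (size _) (size _) h1 h2 => u v; lia.
  by apply: leq_trans (size_scale_leq _ _) _; rewrite size_polyXn !ltnS.
move=> /(_ sz) [] /eqP; rewrite mulf_eq0 invr_eq0 pnatr_eq0 /= => /eqP.
rewrite (eq_bigr (fun i => k%:R * x i ^+ k.-1 - (k%:R + 2 * lambda + 1) * x i ^+ k.+1)).
  by rewrite sumrB -!mulr_sumr => /eqP; rewrite subr_eq0 => /eqP.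
move=> i _; rewrite /f derivXn -scaler_nat !hornerE/= exprS.
by case: k {k4 f sz} => [|k]; rewrite /= ?exprS; ring.
Qed.

(** Even k in the recurrence kill the odd power sums, as 2 lambda + 1, 2 lambda + 3 and 2 lambda + 5
    are positive. The cases k = 1 and k = 3 both involve lambda, which is eliminated between
    them. *)
Lemma design_power_sums : [/\ s 1 = 0, s 3 = 0, s 5 = 0 &
  (n.+1%:R + 2 * s 2) * s 4 = 3 * s 2 ^+ 2].
Proof.
have e0 := @design_power_sum_rec 0 isT.
have e1 := @design_power_sum_rec 1 isT.
have e2 := @design_power_sum_rec 2 isT.
have e3 := @design_power_sum_rec 3 isT.
have e4 := @design_power_sum_rec 4 isT.
have s0 : s 0 = n.+1%:R by rewrite /s sumr_const card_ord.
rewrite /= s0 in e0 e1 e2 e3 e4.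
have l1 : 2 * lambda + 1 != 0 by rewrite gt_eqF//; move: lambda_gt; lra.
have s1 : s 1 = 0 by apply: (mulfI l1); lra.
have l3 : 2 * lambda + 3 != 0 by rewrite gt_eqF//; move: lambda_gt; lra.
have s3 : s 3 = 0 by apply: (mulfI l3); rewrite s1 in e2; lra.
have l5 : 2 * lambda + 5 != 0 by rewrite gt_eqF//; move: lambda_gt; lra.
have s5 : s 5 = 0 by apply: (mulfI l5); rewrite s3 in e4; lra.
split=> //.
have -> : n.+1%:R = (2 * lambda + 2) * s 2 by lra.
have e3' : (2 * lambda + 4) * s 4 = 3 * s 2 by lra.
transitivity ((2 * lambda + 4) * s 4 * s 2); first by ring.
by rewrite e3'; ring.
Qed.

End design_power_sums.

(** The relations between power sums are free of lambda, so they descend to the rationals along the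
    injective morphism [ratr], whatever the real number lambda is. *)
Lemma rational_design_power_sums (R : realType) (n : nat) (lambda : R)
    (x : 'I_n.+1 -> R) : - 2^-1 < lambda ->
  is_rational_design 5 `]-1, 1[ (gegenbauer_density lambda) x ->
  exists q : 'I_n.+1 -> rat, injective q /\
    [/\ \sum_i q i = 0, \sum_i q i ^+ 3 = 0, \sum_i q i ^+ 5 = 0 &
      (n.+1%:R + 2 * \sum_i q i ^+ 2) * \sum_i q i ^+ 4
        = 3 * (\sum_i q i ^+ 2) ^+ 2].
Proof.
move=> l_gt [dx /choice[q xE]]; exists q; split.
  by have [inj _ _] := dx; move=> i j /(congr1 (@ratr R)); rewrite -!xE => /inj.
have sE k : \sum_i x i ^+ k = ratr (\sum_i q i ^+ k).
  by rewrite rmorph_sum; apply: eq_bigr => i _; rewrite xE rmorphXn.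
have [s1 s3 s5 s24] := design_power_sums l_gt dx.
split; apply: (fmorph_inj (@ratr R)).
- by rewrite rmorph0 -s1 sE; congr ratr; apply: eq_bigr.
- by rewrite rmorph0 -s3 sE.
- by rewrite rmorph0 -s5 sE.
- by move: s24; rewrite !sE !(rmorph_nat, rmorphXn, rmorphM, rmorphD).
Qed.

(** * Designs with four and five points *)

(** When the sum vanishes, the sum of cubes is 3 (a + b)(a + c)(a + d). Hence two points are
    opposite, and so are the other two; distinctness gives the inequalities on u and v. *)
Lemma four_points_symmetric (a b c d : rat) : uniq [:: a; b; c; d] ->
  a + b + c + d = 0 -> a ^+ 3 + b ^+ 3 + c ^+ 3 + d ^+ 3 = 0 ->
  exists u v : rat, [/\ u != 0, v != 0, u != v, u != - v &
    a ^+ 2 + b ^+ 2 + c ^+ 2 + d ^+ 2 = 2 * (u ^+ 2 + v ^+ 2) /\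
    a ^+ 4 + b ^+ 4 + c ^+ 4 + d ^+ 4 = 2 * (u ^+ 4 + v ^+ 4)].
Proof.
rewrite /= !inE !negb_or !andbT => /and3P[/and3P[ab ac ad] /andP[bc bd] cd] p1 p3.
have /eqP : (a + b) * (a + c) * (a + d) = 0.
  have dE : d = - (a + b + c) by lra.
  by move: p3; rewrite dE; lra.
have neq0 (u v : rat) : u != v -> v = - u -> u != 0.
  by move=> uv e; apply: contraNneq uv => u0; rewrite e u0 oppr0.
rewrite !mulf_eq0 -orbA => /or3P[] /eqP h.
- have bE : b = - a by lra.
  have dE : d = - c by lra.
  exists a, c; split=> //; [exact: neq0 ab _|exact: neq0 cd _|by rewrite -dE|].
  by rewrite bE dE; split; ring.
- have cE : c = - a by lra.
  have dE : d = - b by lra.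
  exists a, b; split=> //; [exact: neq0 ac _|exact: neq0 bd _|by rewrite -dE|].
  by rewrite cE dE; split; ring.
- have dE : d = - a by lra.
  have cE : c = - b by lra.
  exists a, b; split=> //; [exact: neq0 ad _|exact: neq0 bc _|by rewrite -cE|].
  by rewrite cE dE; split; ring.
Qed.

Lemma five_points_symmetric (a b c d e : rat) : uniq [:: a; b; c; d; e] ->
  a + b + c + d + e = 0 ->
  a ^+ 3 + b ^+ 3 + c ^+ 3 + d ^+ 3 + e ^+ 3 = 0 ->
  a ^+ 5 + b ^+ 5 + c ^+ 5 + d ^+ 5 + e ^+ 5 = 0 ->
  exists u v : rat, [/\ u != 0, v != 0, u != v, u != - v &
    a ^+ 2 + b ^+ 2 + c ^+ 2 + d ^+ 2 + e ^+ 2 = 2 * (u ^+ 2 + v ^+ 2) /\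
    a ^+ 4 + b ^+ 4 + c ^+ 4 + d ^+ 4 + e ^+ 4 = 2 * (u ^+ 4 + v ^+ 4)].
Proof.
move=> Uabcde p1 p3 p5.
(* One point is 0, and swapping it with [e] leaves the four-point situation. *)
wlog e0 : a b c d e Uabcde p1 p3 p5 / e = 0; last first.
  rewrite e0 !expr0n/= !addr0 in p1 p3 *.
  apply: four_points_symmetric => //.
  by move: Uabcde; rewrite (rcons_uniq [:: a; b; c; d]) => /andP[].
move=> H.
have /eqP : a * b * c * d * e = 0.
  (* Newton's identities give p5 = 5 e5 - 5 e2 e3 and p3 = 3 e3 when e1 = 0. *)
  pose e2 := a * b + a * c + a * d + a * e + b * c + b * d + b * e + c * d
    + c * e + d * e.
  have eE : e = - (a + b + c + d) by lra.
  have : 15 * (a * b * c * d * e) =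
    3 * (a ^+ 5 + b ^+ 5 + c ^+ 5 + d ^+ 5 + e ^+ 5) +
    5 * e2 * (a ^+ 3 + b ^+ 3 + c ^+ 3 + d ^+ 3 + e ^+ 3).
    by rewrite /e2 eE; ring.
  by rewrite p3 p5 !mulr0 addr0; lra.
rewrite !mulf_eq0 => /orP[/orP[/orP[/orP[]|]|]|] /eqP h.
- have [||||u [v [? ? ? ? [e1 e2]]]] := H e b c d a _ _ _ _ h.
  + by rewrite (perm_uniq (s2 := [:: a; b; c; d; e]))//; apply/permP => P /=; lia.
  + lra.
  + lra.
  + lra.
  + by exists u, v; split=> //; split; lra.
- have [||||u [v [? ? ? ? [e1 e2]]]] := H a e c d b _ _ _ _ h.
  + by rewrite (perm_uniq (s2 := [:: a; b; c; d; e]))//; apply/permP => P /=; lia.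
  + lra.
  + lra.
  + lra.
  + by exists u, v; split=> //; split; lra.
- have [||||u [v [? ? ? ? [e1 e2]]]] := H a b e d c _ _ _ _ h.
  + by rewrite (perm_uniq (s2 := [:: a; b; c; d; e]))//; apply/permP => P /=; lia.
  + lra.
  + lra.
  + lra.
  + by exists u, v; split=> //; split; lra.
- have [||||u [v [? ? ? ? [e1 e2]]]] := H a b c e d _ _ _ _ h.
  + by rewrite (perm_uniq (s2 := [:: a; b; c; d; e]))//; apply/permP => P /=; lia.
  + lra.
  + lra.
  + lra.
  + by exists u, v; split=> //; split; lra.
- exact: H h.
Qed.

Unset Implicit Arguments.

Theorem theorem2p21 (R : realType) :
  ((forall x1 x2 : rat,
      2 * (x1 ^+ 4 + x2 ^+ 4) * (x1 ^+ 2 + x2 ^+ 2 + 1)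
        = 3 * (x1 ^+ 2 + x2 ^+ 2) ^+ 2
      <-> (x1, x2) \in [:: (-1, -1); (-1, 1); (0, 0); (1, -1); (1, 1)])
   /\
   (forall lambda : R, - 2^-1 < lambda ->
      ~ exists x : 'I_4 -> R,
          is_rational_design 5 `]-1, 1[ (gegenbauer_density lambda) x))
  /\
  ((forall x1 x2 : rat,
      (x1 ^+ 4 + x2 ^+ 4) * (4 * x1 ^+ 2 + 4 * x2 ^+ 2 + 5)
        = 6 * (x1 ^+ 2 + x2 ^+ 2) ^+ 2
      <-> (x1, x2) \in
            [:: (- 2^-1, 0); (0, - 2^-1); (0, 0); (0, 2^-1); (2^-1, 0)])
   /\
   (forall lambda : R, - 2^-1 < lambda ->
      ~ exists x : 'I_5 -> R,
          is_rational_design 5 `]-1, 1[ (gegenbauer_density lambda) x)).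
Proof.
split; split.
- exact: gegenbauer4_curve.
- move=> lambda l_gt [x /(rational_design_power_sums l_gt)[q [inj []]]].
  rewrite !big_ord_recl !big_ord0 !addr0 !addrA => p1 p3 _.
  have [|u [v [u0 v0 uv uNv [-> ->]]]] := four_points_symmetric _ p1 p3.
    by rewrite /= !inE !(inj_eq inj).
  move=> e.
  (* Every listed point with nonzero coordinates has u = v or u = -v, which distinctness of the
     design points forbids. *)
  have /gegenbauer4_curve : 2 * (u ^+ 4 + v ^+ 4) * (u ^+ 2 + v ^+ 2 + 1)
      = 3 * (u ^+ 2 + v ^+ 2) ^+ 2 by lra.
  rewrite !inE !xpair_eqE (negPf u0) (negPf v0) /=.
  by move=> /or4P[] /andP[/eqP uE /eqP vE]; move: uv uNv; rewrite uE vE ?opprK ?eqxx.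
- exact: gegenbauer5_curve.
- move=> lambda l_gt [x /(rational_design_power_sums l_gt)[q [inj []]]].
  rewrite !big_ord_recl !big_ord0 !addr0 !addrA => p1 p3 p5.
  have [|u [v [u0 v0 uv uNv [-> ->]]]] := five_points_symmetric _ p1 p3 p5.
    by rewrite /= !inE !(inj_eq inj).
  move=> e.
  (* Every listed point has a zero coordinate, whereas u and v are nonzero. *)
  have /gegenbauer5_curve : (u ^+ 4 + v ^+ 4) * (4 * u ^+ 2 + 4 * v ^+ 2 + 5)
      = 6 * (u ^+ 2 + v ^+ 2) ^+ 2 by lra.
  by rewrite !inE !xpair_eqE (negPf u0) (negPf v0) /= !andbF.
Qed.
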